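(* For every finite digraph $G=(V,E)$ and every threshold function $t:V\to\mathbb{N}$, every execution of the algorithm MTS on input $(G,t)$ outputs a target set for $G$ with thresholds $t$.
   Context: Digraphs are finite, without loops. For a digraph $G=(V,E)$ and $v\in V$, $\Gamma^{in}(v)=\{u:(u,v)\in E\}$ and $\Gamma^{out}(v)=\{u:(v,u)\in E\}$. Given thresholds $t:V\to\mathbb{N}=\{0,1,2,\dots\}$ and $S\subseteq V$, the activation process starting at $S$ is $A_0=S$ and $A_\ell=A_{\ell-1}\cup\{u\in V: |\Gamma^{in}(u)\cap A_{\ell-1}|\ge t(u)\}$ for $\ell\ge1$. $S$ is a target set for $(G,t)$ if $A_\lambda=V$ for some $\lambda\ge0$. Algorithm MTS on input $(G,t)$: set $S=\emptyset$, $L=\emptyset$, $U=V$, and for each $v\in V$ set $k(v)=t(v)$, $\delta(v)=|\Gamma^{in}(v)|$. While $U\neq\emptyset$, perform one iteration as follows. Case 1: if some $v\in U$ has $k(v)=0$, select such a $v$; for each $u\in\Gamma^{out}(v)\cap U$ set $k(u)=\max(k(u)-1,0)$ and, if $v\notin L$, set $\delta(u)=\delta(u)-1$; then set $U=U\setminus\{v\}$. Case 2: otherwise, if some $v\in U\setminus L$ has $\delta(v)<k(v)$, select such a $v$; set $S=S\cup\{v\}$; for each $u\in\Gamma^{out}(v)\cap U$ set $k(u)=k(u)-1$ and $\delta(u)=\delta(u)-1$; then set $U=U\setminus\{v\}$. Case 3: otherwise, select $v\in U\setminus L$ maximizing $\frac{k(u)}{\delta(u)(\delta(u)+1)}$ over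 $u\in U\setminus L$; for each $u\in\Gamma^{out}(v)\cap U$ set $\delta(u)=\delta(u)-1$; set $L=L\cup\{v\}$. When $U=\emptyset$, return $S$. Whenever several nodes qualify in a case, one of them is chosen arbitrarily. *)

(* Defs.v *)
From Stdlib Require Import Relation_Operators.
From mathcomp Require Import all_boot all_order all_algebra.

Set Implicit Arguments.
Unset Strict Implicit.
Unset Printing Implicit Defensive.

Local Open Scope ring_scope.

(* A loopless digraph is a finType V with an irreflexive edge relation e,
   where e u v means (u, v) \in E. *)

Definition in_nbrs (V : finType) (e : rel V) (v : V) : {set V} :=
  [set u | e u v].

Definition out_nbrs (V : finType) (e : rel V) (v : V) : {set V} :=
  [set u | e v u].

Fixpoint activation (V : finType) (e : rel V) (t : V -> nat) (S : {set V})
    (l : nat) : {set V} :=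
  if l is l'.+1 then
    let A := activation e t S l' in
    A :|: [set u | (t u <= #|in_nbrs e u :&: A|)%N]
  else S.

Definition target_set (V : finType) (e : rel V) (t : V -> nat) (S : {set V})
    : Prop :=
  exists l : nat, activation e t S l = [set: V].

(* k and delta are integer valued, so that the subtractions of the algorithm
   are not truncated. *)
Record mts_state (V : finType) := MtsState {
  st_S : {set V};
  st_L : {set V};
  st_U : {set V};
  st_k : {ffun V -> int};
  st_delta : {ffun V -> int}
}.

Definition mts_init (V : finType) (e : rel V) (t : V -> nat) : mts_state V :=
  MtsState set0 set0 [set: V]
    [ffun v => (t v)%:Z] [ffun v => #|in_nbrs e v|%:Z].

(* Only evaluated at nodes of U :\: L when neither of the first two cases
   applies; there 0 < k u <= delta u, so the denominator is not zero. *)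
Definition mts_ratio (V : finType) (k delta : {ffun V -> int}) (u : V) : rat :=
  (k u)%:~R / (delta u * (delta u + 1))%:~R.

Definition case1_node (V : finType) (s : mts_state V) (v : V) : Prop :=
  v \in st_U s /\ st_k s v = 0.

Definition case2_node (V : finType) (s : mts_state V) (v : V) : Prop :=
  v \in st_U s :\: st_L s /\ st_delta s v < st_k s v.

Definition case3_node (V : finType) (s : mts_state V) (v : V) : Prop :=
  v \in st_U s :\: st_L s /\
  forall u : V, u \in st_U s :\: st_L s ->
    mts_ratio (st_k s) (st_delta s) u <= mts_ratio (st_k s) (st_delta s) v.

Definition case1_update (V : finType) (e : rel V) (s : mts_state V) (v : V)
    : mts_state V :=
  let: MtsState S0 L U k delta := s in
  MtsState S0 L (U :\ v)
    [ffun u => if u \in out_nbrs e v :&: U then Num.max (k u - 1) 0 else k u]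
    [ffun u => if (u \in out_nbrs e v :&: U) && (v \notin L)
               then delta u - 1 else delta u].

Definition case2_update (V : finType) (e : rel V) (s : mts_state V) (v : V)
    : mts_state V :=
  let: MtsState S0 L U k delta := s in
  MtsState (v |: S0) L (U :\ v)
    [ffun u => if u \in out_nbrs e v :&: U then k u - 1 else k u]
    [ffun u => if u \in out_nbrs e v :&: U then delta u - 1 else delta u].

Definition case3_update (V : finType) (e : rel V) (s : mts_state V) (v : V)
    : mts_state V :=
  let: MtsState S0 L U k delta := s in
  MtsState S0 (v |: L) U k
    [ffun u => if u \in out_nbrs e v :&: U then delta u - 1 else delta u].

(* One iteration of the while loop; the relation is nondeterministic because
   ties are broken arbitrarily. *)
Inductive mts_step (V : finType) (e : rel V) (s : mts_state V)
    : mts_state V -> Prop :=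
| MtsCase1 (v : V) :
    st_U s <> set0 ->
    case1_node s v ->
    mts_step e s (case1_update e s v)
| MtsCase2 (v : V) :
    st_U s <> set0 ->
    ~ (exists w, case1_node s w) ->
    case2_node s v ->
    mts_step e s (case2_update e s v)
| MtsCase3 (v : V) :
    st_U s <> set0 ->
    ~ (exists w, case1_node s w) ->
    ~ (exists w, case2_node s w) ->
    case3_node s v ->
    mts_step e s (case3_update e s v).

Definition mts_reachable (V : finType) (e : rel V) (t : V -> nat)
    (s : mts_state V) : Prop :=
  clos_refl_trans (mts_state V) (@mts_step V e) (mts_init e t) s.

Definition mts_infinite_execution (V : finType) (e : rel V) (t : V -> nat)
    (run : nat -> mts_state V) : Prop :=
  run 0%N = mts_init e t /\ forall i : nat, mts_step e (run i) (run i.+1).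

(* A finite execution is complete when no further iteration can be performed,
   be it because the loop guard fails or because no node can be selected. *)
Definition mts_halts_in (V : finType) (e : rel V) (t : V -> nat)
    (s : mts_state V) : Prop :=
  mts_reachable e t s /\ ~ (exists s', mts_step e s s').

(* The execution halting in s does so by exiting the loop, and returns X. *)
Definition mts_returns (V : finType) (s : mts_state V) (X : {set V}) : Prop :=
  st_U s = set0 /\ st_S s = X.

(* Main.v *)
Require Import Defs.
From mathcomp Require Import all_boot all_order all_algebra.
From Stdlib Require Import Relation_Operators.
From mathcomp Require Import zify.

Set Implicit Arguments.
Unset Strict Implicit.
Unset Printing Implicit Defensive.

Import Order.TTheory GRing.Theory Num.Theory.

(** Each iteration removes a node from [U] or from [U :\: L], so the loop
    terminates. Removed nodes are activated by [S], because [k u] always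
    dominates the threshold of [u] minus the number of its in-neighbours outside
    [U]. The delicate point is that the loop never gets stuck with a nonempty
    [U] included in [L]: a node enters [L] only when [k v <= delta v], so among
    the nodes of any nonempty [X] included in [U :&: L], the last one to enter
    [L] needs no more activations than it has in-neighbours in [U :\: X].
    With [X := U] this yields a node with [k u = 0], to which Case 1 applies. *)

Section MTS.

Variables (V : finType) (e : rel V) (t : V -> nat).
Hypothesis e_loopless : irreflexive e.
Implicit Types (s : mts_state V) (A S L U X : {set V}) (u v w : V).

Lemma activation_mono S S' l :
  S \subset S' -> activation e t S l \subset activation e t S' l.
Proof.
move=> sS; elim: l => //= l IHl; apply: setUSS => //.
apply/subsetP => u; rewrite !inE => /leq_trans; apply.
by apply: subset_leq_card; apply: setIS.
Qed.

Lemma subset_activation S l : S \subset activation e t S l.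
Proof. by elim: l => //= l IHl; apply: subset_trans IHl (subsetUl _ _). Qed.

Definition mts_measure s : nat := #|st_U s| + #|st_U s :\: st_L s|.

Lemma mts_step_measure s s' :
  mts_step e s s' -> (mts_measure s' < mts_measure s)%N.
Proof.
case: s => S L U k d; rewrite /mts_measure.
have dropU v : v \in U ->
    (#|U :\ v| + #|(U :\ v) :\: L| < #|U| + #|U :\: L|)%N.
  move=> vU; rewrite -addSn [in X in (_ <= X)%N](cardsD1 v U) vU.
  by rewrite leq_add2l; apply: subset_leq_card; apply: setSD; apply: subsetDl.
case=> v _ /=; first by case=> /= vU _; apply: dropU.
  by move=> _ [/= + _]; rewrite inE => /andP[_]; apply: dropU.
move=> _ _ [/= vUL _].
by rewrite ltn_add2l [X in (_ < X)%N](cardsD1 v) vUL setDDl [L :|: _]setUC.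
Qed.

Lemma no_infinite_mts run : ~ mts_infinite_execution e t run.
Proof.
case=> _ step.
have bound i : (mts_measure (run i) + i <= mts_measure (run 0))%N.
  elim: i => [|i IHi]; first by rewrite addn0.
  by apply: leq_trans IHi; rewrite addnS -addSn leq_add2r; apply: mts_step_measure.
by have := bound (mts_measure (run 0)).+1; lia.
Qed.

(** [inv_unlocked] ranges over every [X], although only [X := U] is needed at the end: [U] shrinks
    during the run, and a nonempty subset of a later [U :&: L] must still be covered. *)
Record mts_invariant s : Prop := MtsInvariant {
  inv_k_ge0 : forall u, u \in st_U s -> (0 <= st_k s u)%R;
  inv_delta : forall u, u \in st_U s ->
    st_delta s u = #|in_nbrs e u :&: (st_U s :\: st_L s)|%:Z%R;
  inv_threshold : forall u, u \in st_U s ->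
    ((t u)%:Z <= st_k s u + #|in_nbrs e u :&: ~: st_U s|%:Z)%R;
  inv_unlocked : forall X, X \subset st_U s :&: st_L s -> X != set0 ->
    exists2 u, u \in X &
      (st_k s u <= #|in_nbrs e u :&: (st_U s :\: X)|%:Z)%R;
  inv_activated : exists l, ~: st_U s \subset activation e t (st_S s) l
}.

Lemma mts_invariant_init : mts_invariant (mts_init e t).
Proof.
split=> /=.
- by move=> u _; rewrite ffunE.
- by move=> u _; rewrite ffunE setD0 setIT.
- by move=> u _; rewrite ffunE setCT setI0 cards0 addr0.
- by move=> X; rewrite setI0 subset0 => ->.
- by exists 0; rewrite setCT.
Qed.

Lemma card_in_nbrsD1 A u v : v \in A ->
  #|in_nbrs e u :&: A| = (e v u + #|in_nbrs e u :&: (A :\ v)|)%N.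
Proof. by move=> vA; rewrite (cardsD1 v) !inE vA andbT setIDA. Qed.

Lemma card_in_nbrsU1 A u v : v \notin A ->
  #|in_nbrs e u :&: (v |: A)| = (e v u + #|in_nbrs e u :&: A|)%N.
Proof. by move=> vA; rewrite (card_in_nbrsD1 u (setU11 v A)) setU1K. Qed.

(** Treats Cases 1 and 2 together. The bounds on [k'] allow both the truncated decrement of Case 1
    and the plain one of Case 2; [vact] records the two reasons why [v] gets activated. *)
Lemma mts_invariant_remove S S' L U (k k' d d' : {ffun V -> int}) v :
  v \in U -> S \subset S' ->
  (v \in S' \/ k v = 0%R) ->
  (forall u, u \in U :\ v -> [/\ 0 <= k' u, k' u <= Num.max (k u - (e v u)%:Z) 0,
      k u <= k' u + (e v u)%:Z & d' u = d u - (e v u && (v \notin L))%:Z]%R) ->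
  mts_invariant (MtsState S L U k d) ->
  mts_invariant (MtsState S' L (U :\ v) k' d').
Proof.
move=> vU sS vact upd [/= k0 dE tk unl [l act]].
have inU u : u \in U :\ v -> u \in U by rewrite inE => /andP[].
have CD1 : ~: (U :\ v) = v |: ~: U.
  by apply/setP => x; rewrite !inE negb_and negbK.
have cC u : #|in_nbrs e u :&: ~: (U :\ v)| = (e v u + #|in_nbrs e u :&: ~: U|)%N.
  by rewrite CD1 card_in_nbrsU1 // inE vU.
split=> /=.
- by move=> u /upd[].
- move=> u uU; have [_ _ _ ->] := upd u uU; rewrite dE ?inU //.
  have [vL|vL] := boolP (v \in L).
    rewrite andbF subr0; congr (Posz #|_ :&: _|); apply/setP => x.
    by rewrite !inE; case: eqVneq => // ->; rewrite vL.
  rewrite andbT (@card_in_nbrsD1 _ _ v); last by rewrite !inE vL.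
  by rewrite setDDl setUC -setDDl; lia.
- by move=> u uU; have [_ _ k1 _] := upd u uU; have := tk u (inU u uU); rewrite cC; lia.
(* The old witness still works: since [v] is outside [X], removing it from [U] costs [u] one counted
   in-neighbour exactly when there is an edge from [v] to [u], and then [k u] also drops by one
   unless truncated at 0. *)
- move=> X; rewrite subsetI subsetD1 => /andP[/andP[XU vX] XL] Xn0.
  have [|u uX ku] := unl X _ Xn0; first by rewrite subsetI XU.
  exists u => //; have uU : u \in U :\ v.
    by rewrite !inE (subsetP XU) // andbT; apply: contraNneq vX => <-.
  have [_ k1 _ _] := upd u uU.
  move: ku; rewrite (@card_in_nbrsD1 _ _ v); last by rewrite inE vX.
  by rewrite setDDl setUC -setDDl; lia.
(* One extra round lets [v] join the nodes already outside [U]. *)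
- exists l.+1; rewrite CD1 subUset sub1set /=; apply/andP; split; last first.
    by apply: subset_trans act (subset_trans (activation_mono l sS) (subsetUl _ _)).
  case: vact => [vS|kv0].
    by rewrite inE (subsetP (subset_activation S' l)).
  (* As [k v = 0], [inv_threshold] says that the in-neighbours of [v] outside [U], all active by
     round [l], already meet its threshold. *)
  rewrite !inE; apply/orP; right.
  have := tk v vU; rewrite kv0 add0r lez_nat => /leq_trans; apply.
  apply: subset_leq_card; apply: setIS.
  exact: subset_trans act (activation_mono l sS).
Qed.

Lemma mts_invariant_step s s' :
  mts_step e s s' -> mts_invariant s -> mts_invariant s'.
Proof.
case: s => S L U k d; case=> v _ /=.
- case=> /= vU kv0 inv; apply: (mts_invariant_remove vU _ _ _ inv) => //; first by right.
  move=> u; rewrite !inE => /andP[_ uU].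
  have := inv_k_ge0 inv uU; rewrite /= !ffunE !inE uU andbT.
  by case: (e v u); case: (v \in L); split => //=; lia.
- move=> no1 [/= + dk] inv; rewrite inE => /andP[vL vU].
  apply: (mts_invariant_remove vU _ _ _ inv) => //; first exact: subsetUr.
    by left; apply: setU11.
  move=> u; rewrite !inE => /andP[_ uU].
  (* Case 1 does not apply, so [k u] is positive and the decrement stays nonnegative. *)
  have ku : (k u != 0)%R by apply/eqP => ku; apply: no1; exists u.
  have := inv_k_ge0 inv uU; rewrite /= !ffunE !inE uU vL andbT.
  by case: (e v u); split => //=; lia.
move=> no1 no2 [/= vUL _] [/= k0 dE tk unl act].
have [vL vU] : v \notin L /\ v \in U by move: vUL; rewrite inE => /andP[].
split=> //=.
- move=> u uU; rewrite ffunE !inE uU andbT dE // (card_in_nbrsD1 u vUL).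
  by rewrite setDDl [L :|: _]setUC; case: (e v u); lia.
move=> X; rewrite subsetI => /andP[XU XL] Xn0.
(* If [v] is not in [X], then [X] already lies in the old [L]. Otherwise [v] is the last node of [X]
   to enter [L] and is itself the witness. *)
have [vX|vX] := boolP (v \in X); last first.
  apply: unl => //; rewrite subsetI XU; apply/subsetP => x xX.
  have := subsetP XL x xX; rewrite !inE => /orP[/eqP xv|//].
  by rewrite -xv xX in vX.
exists v => //.
have kd : (k v <= d v)%R.
  by rewrite leNgt; apply/negP => dk; apply: no2; exists v.
(* The in-neighbours counted by [d v] lie outside [L], so the only one that could belong to [X] is
   [v], which has no loop. *)
apply: le_trans kd _; rewrite dE // lez_nat; apply: subset_leq_card.
apply/subsetP => w; rewrite !inE => /and3P[wv wL wU]; rewrite wv wU andbT /=.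
apply/negP => /(subsetP XL); rewrite !inE (negbTE wL) orbF => /eqP wE.
by rewrite wE e_loopless in wv.
Qed.

Lemma mts_invariant_reachable s : mts_reachable e t s -> mts_invariant s.
Proof.
suff: forall s1 s2, clos_refl_trans _ (@mts_step V e) s1 s2 ->
    mts_invariant s1 -> mts_invariant s2.
  by move=> H /H; apply; apply: mts_invariant_init.
move=> s1 s2; elim=> [x y|//|x y z _ IH1 _ IH2 /IH1 /IH2 //].
exact: mts_invariant_step.
Qed.

Lemma mts_progress s : mts_invariant s -> st_U s != set0 ->
  exists s', mts_step e s s'.
Proof.
move=> inv Un0; have Un0' := elimN eqP Un0.
have [/existsP[v /andP[vU /eqP kv]]|no1] :=
  boolP [exists v, (v \in st_U s) && (st_k s v == 0%R)].
  by exists (case1_update e s v); apply: MtsCase1.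
have {}no1 : ~ exists w, case1_node s w.
  by case=> w [wU kw]; case/existsP: no1; exists w; rewrite wU kw eqxx.
have [/existsP[v /andP[vUL dk]]|no2] :=
  boolP [exists v, (v \in st_U s :\: st_L s) && (st_delta s v < st_k s v)%R].
  by exists (case2_update e s v); apply: MtsCase2.
have {}no2 : ~ exists w, case2_node s w.
  by case=> w [wU kw]; case/existsP: no2; exists w; rewrite wU kw.
(* Either [U] is included in [L], which contradicts the failure of Case 1, or [U :\: L] is nonempty
   and the ratio attains a maximum on it. *)
have [UL0|[v0 v0UL]] := set_0Vmem (st_U s :\: st_L s).
  have UL : st_U s \subset st_U s :&: st_L s.
    by rewrite subsetI subxx -setD_eq0 UL0 eqxx.
  have [u uU] := inv_unlocked inv UL Un0.
  rewrite setDv setI0 cards0 => ku0; case: no1; exists u; split=> //.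
  by apply/eqP; rewrite eq_le ku0 (inv_k_ge0 inv uU).
pose v := [arg max_(v > v0 in st_U s :\: st_L s)
             mts_ratio (st_k s) (st_delta s) v]%O.
exists (case3_update e s v); apply: MtsCase3 => //.
by rewrite /v; case: arg_maxP => // w wUL wmax; split.
Qed.

Lemma mts_halts_target_set s : mts_halts_in e t s ->
  exists X, mts_returns s X /\ target_set e t X.
Proof.
case=> /mts_invariant_reachable inv stuck.
have U0 : st_U s = set0.
  by apply/eqP; apply: contraT => Un0; case: stuck; apply: mts_progress.
exists (st_S s); split=> //.
have [l] := inv_activated inv; rewrite U0 setC0 subTset => /eqP ?.
by exists l.
Qed.

End MTS.

Theorem theorem1 (V : finType) (e : rel V) (e_loopless : irreflexive e)
    (t : V -> nat) :
  ~ (exists run : nat -> mts_state V, mts_infinite_execution e t run) /\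
  (forall s : mts_state V, mts_halts_in e t s ->
     exists X : {set V}, mts_returns s X /\ target_set e t X).
Proof.
split; first by case=> run; apply: no_infinite_mts.
by move=> s; apply: mts_halts_target_set.
Qed.
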